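(* Let $\mathfrak{r}_3$ be the real Lie algebra with basis $\{x,y,h\}$ and brackets $[h,x]=x$, $[h,y]=x+y$, $[x,y]=0$. The isomorphism classes of Lie bialgebra structures on $\mathfrak{r}_3$ are given by the following list of cobrackets (matrices with respect to the bases $\{x,y,h\}$ and $\{x\wedge y,\,y\wedge h,\,h\wedge x\}$): $$\begin{pmatrix}0&1&0\\0&0&0\\0&0&1\end{pmatrix}\quad\text{and}\quad \delta_{c_1,b_3}=\begin{pmatrix}0&0&c_1\\0&0&0\\0&b_3&0\end{pmatrix},\ b_3\in\mathbb{R},\ c_1\in\{0,1,-1\}.$$ That is, each of these is a Lie bialgebra cobracket on $\mathfrak{r}_3$, and every real Lie bialgebra with underlying Lie algebra $\mathfrak{r}_3$ is isomorphic to exactly one of them.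
   Context: A Lie bialgebra over a field $\mathbb{K}$ is a triple $(\mathfrak{g},[-,-],\delta)$ where $(\mathfrak{g},[-,-])$ is a Lie algebra over $\mathbb{K}$ and $\delta:\mathfrak{g}\to\Lambda^2\mathfrak{g}$ is a linear map (the cobracket) such that the induced map $\delta^*:\Lambda^2\mathfrak{g}^*\to\mathfrak{g}^*$ is a Lie algebra structure on $\mathfrak{g}^*$ (co-Jacobi condition) and $\delta$ is a 1-cocycle, i.e. $\delta[s,t]=[\delta s,t]+[s,\delta t]$ for all $s,t\in\mathfrak g$, with $\mathfrak{g}$ acting on $\Lambda^2\mathfrak{g}$ by the adjoint action ($[s,p\wedge q]=[s,p]\wedge q+p\wedge[s,q]$ and $[p\wedge q,s]=-[s,p\wedge q]$). An isomorphism of Lie bialgebras is a Lie algebra isomorphism $\phi$ with $\delta'\phi=(\phi\wedge\phi)\delta$. Matrix convention: the columns of the matrix of $\delta$ are the coordinates of $\delta(x),\delta(y),\delta(h)$ (in this order) in the ordered basis $\{x\wedge y,\,y\wedge h,\,h\wedge x\}$ of $\Lambda^2\mathfrak{g}$. *)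

(* Defs.v *)
From HB Require Import structures.
From mathcomp Require Import all_boot all_order all_algebra.
From mathcomp Require Import reals.

Set Implicit Arguments.
Unset Strict Implicit.
Unset Printing Implicit Defensive.

Import GRing.Theory.
Local Open Scope ring_scope.

Record is_lie_bracket (K : fieldType) (V : lmodType K) (br : V -> V -> V) :
    Prop := IsLieBracket {
  lie_linearl : forall v, linear (br^~ v);
  lie_linearr : forall u, linear (br u);
  lie_alternating : forall u, br u u = 0;
  lie_jacobi : forall u v w,
    br u (br v w) + br v (br w u) + br w (br u v) = 0 }.

(* The Lie algebra g is K^n, as row vectors; g (x) g is identified with 'M_n
   by p (x) q = p^T *m q, and Lambda^2 g with the alternating matrices, by
   p /\ q = p (x) q - q (x) p. See [ext2_span], [ext2_map_wedge] and
   [ext2_act_wedge]. *)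
Section ExteriorSquare.
Variable K : fieldType.

Definition wedge (n : nat) (p q : 'rV[K]_n) : 'M[K]_n :=
  p^T *m q - q^T *m p.

Definition in_ext2 (n : nat) (w : 'M[K]_n) : Prop :=
  w^T = - w /\ forall i, w i i = 0.

(* phi /\ phi, for phi linear *)
Definition ext2_map (m n : nat) (phi : 'rV[K]_m -> 'rV[K]_n) (w : 'M[K]_m) :
    'M[K]_n :=
  (lin1_mx phi)^T *m w *m lin1_mx phi.

(* [s, w] for w in Lambda^2 g, for br bilinear *)
Definition ext2_act (n : nat) (br : 'rV[K]_n -> 'rV[K]_n -> 'rV[K]_n)
    (s : 'rV[K]_n) (w : 'M[K]_n) : 'M[K]_n :=
  (lin1_mx (br s))^T *m w + w *m lin1_mx (br s).

Lemma wedge_in_ext2 (n : nat) (p q : 'rV[K]_n) : in_ext2 (wedge p q).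
Proof.
split; first by rewrite /wedge linearB /= !trmx_mul !trmxK opprB.
by move=> i; rewrite /wedge !mxE !big_ord1 !mxE mulrC subrr.
Qed.

Lemma ext2_span (n : nat) (w : 'M[K]_n) : in_ext2 w ->
  w = \sum_(i < n) \sum_(j < n | (i < j)%N)
        w i j *: wedge (delta_mx 0 i) (delta_mx 0 j).
Proof.
case=> wT w0.
have wE i j : w j i = - w i j by have/matrixP/(_ i j) := wT; rewrite !mxE.
have dE (i j : 'I_n) : wedge (delta_mx 0 i) (delta_mx 0 j)
    = delta_mx i j - delta_mx j i :> 'M[K]_n.
  by rewrite /wedge !trmx_delta !mul_delta_mx.
rewrite {1}[w]matrix_sum_delta.
have -> : \sum_i \sum_j w i j *: delta_mx i j
   = \sum_(i < n) \sum_(j < n | (i < j)%N) w i j *: delta_mx i j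
   + \sum_(i < n) \sum_(j < n | (j < i)%N) w i j *: delta_mx i j :> 'M[K]_n.
  rewrite -big_split; apply: eq_bigr => i _ /=.
  rewrite (bigID (fun j : 'I_n => (i < j)%N)) /=; congr (_ + _).
  rewrite (bigD1 i) /= ?ltnn // w0 scale0r add0r.
  by apply: eq_bigl => j; rewrite -leqNgt ltn_neqAle andbC.
have -> : \sum_(i < n) \sum_(j < n | (j < i)%N) w i j *: delta_mx i j
   = \sum_(i < n) \sum_(j < n | (i < j)%N) w j i *: delta_mx j i :> 'M[K]_n.
  by rewrite (exchange_big_dep xpredT).
rewrite -big_split; apply: eq_bigr => i _ /=.
rewrite -big_split; apply: eq_bigr => j _ /=.
by rewrite dE scalerBr (wE i j) scaleNr.
Qed.

Lemma ext2_map_wedge (m n : nat) (phi : {linear 'rV[K]_m -> 'rV[K]_n})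
    (p q : 'rV[K]_m) :
  ext2_map phi (wedge p q) = wedge (phi p) (phi q).
Proof.
rewrite /ext2_map /wedge mulmxBr mulmxBl -!(mul_rV_lin1 phi) !trmx_mul.
by rewrite !mulmxA.
Qed.

Lemma ext2_act_wedge (n : nat) (br : 'rV[K]_n -> 'rV[K]_n -> 'rV[K]_n)
    (s p q : 'rV[K]_n) : linear (br s) ->
  ext2_act br s (wedge p q) = wedge (br s p) q + wedge p (br s q).
Proof.
move=> lin_s.
pose f : {linear 'rV[K]_n -> 'rV[K]_n} := HB.pack (br s)
  (GRing.isLinear.Build K _ _ _ (br s) lin_s).
have E v : br s v = v *m lin1_mx (br s) by rewrite (mul_rV_lin1 f).
rewrite /ext2_act /wedge !E mulmxBr mulmxBl !trmx_mul !mulmxA.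
by rewrite addrACA [RHS]addrACA [X in _ + X = _]addrC.
Qed.

End ExteriorSquare.

Section LieBialgebra.
Variable K : fieldType.

(* Covectors are column vectors, with f(v) = v *m f. For w in Lambda^2 g, the
   pairing of f /\ g with w is f^T *m w *m g, as
   <f /\ g, p /\ q> = f(p) g(q) - f(q) g(p). *)
Definition dual_bracket (n : nat) (delta : 'rV[K]_n -> 'M[K]_n)
    (f g : 'cV[K]_n) : 'cV[K]_n :=
  \col_k (f^T *m delta (delta_mx 0 k) *m g) 0 0.

Record is_lie_bialgebra (n : nat) (br : 'rV[K]_n -> 'rV[K]_n -> 'rV[K]_n)
    (delta : 'rV[K]_n -> 'M[K]_n) : Prop := IsLieBialgebra {
  bialg_lie : is_lie_bracket br;
  bialg_linear : linear delta;
  bialg_ext2 : forall v, in_ext2 (delta v);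
  bialg_coJacobi : is_lie_bracket (dual_bracket delta);
  (* [delta s, t] = - [t, delta s] *)
  bialg_cocycle : forall s t,
    delta (br s t) = - ext2_act br t (delta s) + ext2_act br s (delta t) }.

Definition lie_bialgebra_iso (m n : nat)
    (br : 'rV[K]_m -> 'rV[K]_m -> 'rV[K]_m) (delta : 'rV[K]_m -> 'M[K]_m)
    (br' : 'rV[K]_n -> 'rV[K]_n -> 'rV[K]_n) (delta' : 'rV[K]_n -> 'M[K]_n) :
    Prop :=
  exists phi : {linear 'rV[K]_m -> 'rV[K]_n},
    [/\ bijective phi,
        forall u v, phi (br u v) = br' (phi u) (phi v)
      & forall v, delta' (phi v) = ext2_map phi (delta v)].

End LieBialgebra.

Section R3.
Variable K : fieldType.

Definition r3_x : 'rV[K]_3 := delta_mx 0 (inord 0).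
Definition r3_y : 'rV[K]_3 := delta_mx 0 (inord 1).
Definition r3_h : 'rV[K]_3 := delta_mx 0 (inord 2).

Definition r3_bracket (u v : 'rV[K]_3) : 'rV[K]_3 :=
  let ux := u 0 (inord 0) in let uy := u 0 (inord 1) in
  let uh := u 0 (inord 2) in
  let vx := v 0 (inord 0) in let vy := v 0 (inord 1) in
  let vh := v 0 (inord 2) in
  (uh * vx - ux * vh) *: r3_x + (uh * vy - uy * vh) *: (r3_x + r3_y).

Lemma r3_bracket_hx : r3_bracket r3_h r3_x = r3_x.
Proof.
rewrite /r3_bracket !mxE -!val_eqE /= !inordK //=.
by rewrite !(mulr0, mul0r, mulr1, mul1r, subr0, oppr0, scale1r, scale0r, addr0).
Qed.

Lemma r3_bracket_hy : r3_bracket r3_h r3_y = r3_x + r3_y.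
Proof.
rewrite /r3_bracket !mxE -!val_eqE /= !inordK //=.
rewrite !(mulr0, mul0r, mulr1, mul1r, subr0).
by rewrite scale0r add0r scale1r.
Qed.

Lemma r3_bracket_xy : r3_bracket r3_x r3_y = 0.
Proof.
rewrite /r3_bracket !mxE -!val_eqE /= !inordK //=.
by rewrite !(mulr0, mul0r, mulr1, mul1r, subr0, oppr0, scale1r, scale0r, add0r).
Qed.

Definition r3_ext2_basis : 3.-tuple 'M[K]_3 :=
  [tuple wedge r3_x r3_y; wedge r3_y r3_h; wedge r3_h r3_x].

(* Column j of D holds the coordinates in [r3_ext2_basis] of the cobracket of
   the j-th vector of the basis x, y, h. *)
Definition r3_cobracket (D : 'M[K]_3) (v : 'rV[K]_3) : 'M[K]_3 :=
  \sum_(j < 3) v 0 j *: \sum_(i < 3) D i j *: tnth r3_ext2_basis i.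

Definition mx3 (rows : seq (seq K)) : 'M[K]_3 :=
  \matrix_(i < 3, j < 3) nth 0 (nth [::] rows i) j.

Definition r3_cobracket_mx0 : 'M[K]_3 :=
  mx3 [:: [:: 0; 1; 0];
          [:: 0; 0; 0];
          [:: 0; 0; 1]].

Definition r3_cobracket_mx (c1 b3 : K) : 'M[K]_3 :=
  mx3 [:: [:: 0; 0;  c1];
          [:: 0; 0;  0];
          [:: 0; b3; 0]].

Definition r3_listed (D : 'M[K]_3) : Prop :=
  D = r3_cobracket_mx0 \/
  exists c1 b3, c1 \in [:: 0; 1; -1] /\ D = r3_cobracket_mx c1 b3.

End R3.

(* Main.v *)
Require Import Defs.
From HB Require Import structures.
From mathcomp Require Import all_boot all_order all_algebra.
From mathcomp Require Import reals.
From mathcomp Require Import ring lra.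

(* For a general linear delta, the cocycle condition on the pairs of basis
   vectors and the co-Jacobi identity leave exactly the three-parameter family
   delta x = 0, delta y = c3 x/\y + b3 h/\x, delta h = c1 x/\y + c3 h/\x.
   Automorphisms of r_3 have the form x |-> a x, y |-> a y + b x,
   h |-> h + p x + q y with a <> 0, and turn (c1, c3, b3) into
   (a^2 c1 - 2 a q c3 + q^2 b3, a c3 - q b3, b3). If b3 <> 0, choose q to kill
   c3; then c1 - c3^2 / b3 is scaled by a^2, so only its sign is invariant. If
   b3 = 0 <> c3, normalise c3 to 1 and choose q to kill c1. If b3 = c3 = 0,
   only the sign of c1 is invariant. *)

Set Implicit Arguments.
Unset Strict Implicit.
Unset Printing Implicit Defensive.

Import Order.TTheory GRing.Theory Num.Theory.

Local Open Scope ring_scope.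

(** * Indices and entries in dimension three *)

Local Notation i0 := (inord 0 : 'I_3).
Local Notation i1 := (inord 1 : 'I_3).
Local Notation i2 := (inord 2 : 'I_3).

Lemma ord3_cases (i : 'I_3) : [\/ i = i0, i = i1 | i = i2].
Proof.
by case: i => [[|[|[|//]]] Hi]; [apply: Or31 | apply: Or32 | apply: Or33];
   apply: val_inj; rewrite /= inordK.
Qed.

Lemma eq_ord3 :
  ((i0 == i1) = false) * ((i0 == i2) = false) * ((i1 == i2) = false) *
  ((i1 == i0) = false) * ((i2 == i0) = false) * ((i2 == i1) = false).
Proof. by rewrite -!val_eqE /= !inordK. Qed.

Lemma sum_ord3 (V : nmodType) (F : 'I_3 -> V) :
  \sum_(i < 3) F i = F i0 + F i1 + F i2.
Proof.
rewrite !big_ord_recl big_ord0 addr0 addrA.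
by congr (F _ + F _ + F _); apply: val_inj; rewrite /= inordK.
Qed.

Lemma row3P (K : fieldType) (u v : 'rV[K]_3) :
  u 0 i0 = v 0 i0 -> u 0 i1 = v 0 i1 -> u 0 i2 = v 0 i2 -> u = v.
Proof. by move=> e0 e1 e2; apply/rowP => j; case: (ord3_cases j) => ->. Qed.

Lemma col3P (K : fieldType) (u v : 'cV[K]_3) :
  u i0 0 = v i0 0 -> u i1 0 = v i1 0 -> u i2 0 = v i2 0 -> u = v.
Proof. by move=> e0 e1 e2; apply/colP => j; case: (ord3_cases j) => ->. Qed.

Lemma mx33P (K : fieldType) (A B : 'M[K]_3) :
  (forall i, [/\ A i i0 = B i i0, A i i1 = B i i1 & A i i2 = B i i2]) -> A = B.
Proof.
by move=> e; apply/matrixP => i j; case: (e i); case: (ord3_cases j) => ->.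
Qed.

(** Unlike [mxE], these rules open only the linear operations and leave basis vectors and products
    folded. *)
Lemma mx_linE (K : fieldType) (m n : nat) :
  (forall (A B : 'M[K]_(m, n)) i j, (A + B) i j = A i j + B i j) *
  (forall (A : 'M[K]_(m, n)) i j, (- A) i j = - A i j) *
  (forall a (A : 'M[K]_(m, n)) i j, (a *: A) i j = a * A i j) *
  (forall i j, (0 : 'M[K]_(m, n)) i j = 0).
Proof. by do ![split] => *; rewrite !mxE. Qed.

Lemma mx3E (K : fieldType) (a b c d e f g h k : K) :
  let M := mx3 [:: [:: a; b; c]; [:: d; e; f]; [:: g; h; k]] in
  ((M i0 i0 = a) * (M i0 i1 = b) * (M i0 i2 = c)) *
  ((M i1 i0 = d) * (M i1 i1 = e) * (M i1 i2 = f)) *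
  ((M i2 i0 = g) * (M i2 i1 = h) * (M i2 i2 = k)).
Proof. by rewrite /= /mx3 !mxE !inordK. Qed.

(* The element p x /\ y + r y /\ h + q h /\ x of Lambda^2 g. *)
Definition alt_mx {K : fieldType} (p r q : K) : 'M[K]_3 :=
  mx3 [:: [:: 0; p; - q]; [:: - p; 0; r]; [:: q; - r; 0]].

(** * Coordinates on the exterior square of a three-dimensional space *)

Section AlternatingMatrices.
Variable K : fieldType.
Implicit Types p r q : K.

Lemma alt_mxD p r q p' r' q' :
  alt_mx p r q + alt_mx p' r' q' = alt_mx (p + p') (r + r') (q + q').
Proof.
by apply: mx33P => i; case: (ord3_cases i) => ->; split;
  rewrite [LHS]mxE !mx3E; ring.
Qed.

Lemma alt_mxZ a p r q : a *: alt_mx p r q = alt_mx (a * p) (a * r) (a * q).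
Proof.
by apply: mx33P => i; case: (ord3_cases i) => ->; split;
  rewrite [LHS]mxE !mx3E; ring.
Qed.

Lemma alt_mxN p r q : - alt_mx p r q = alt_mx (- p) (- r) (- q).
Proof. by rewrite -scaleN1r alt_mxZ !mulN1r. Qed.

Lemma alt_mx_inj p r q p' r' q' :
  alt_mx p r q = alt_mx p' r' q' -> [/\ p = p', r = r' & q = q'].
Proof.
move=> e; split; [have := congr1 (fun w : 'M_3 => w i0 i1) e
  | have := congr1 (fun w : 'M_3 => w i1 i2) e
  | have := congr1 (fun w : 'M_3 => w i2 i0) e]; by rewrite !mx3E.
Qed.

Lemma alt_mx_in_ext2 p r q : in_ext2 (alt_mx p r q).
Proof.
split; last by move=> i; case: (ord3_cases i) => ->; rewrite mx3E.
by apply: mx33P => i; case: (ord3_cases i) => ->; split;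
  rewrite [LHS]mxE alt_mxN !mx3E; ring.
Qed.

Lemma in_ext2_alt_mx (w : 'M[K]_3) : in_ext2 w ->
  w = alt_mx (w i0 i1) (w i1 i2) (w i2 i0).
Proof.
case=> wT w0; have wE i j : w j i = - w i j.
  by move/matrixP/(_ i j): wT; rewrite !mxE.
by apply: mx33P => i; case: (ord3_cases i) => ->;
  split; rewrite !mx3E ?w0 // -wE.
Qed.

Lemma wedge_alt_mx (u v : 'rV[K]_3) :
  wedge u v = alt_mx (u 0 i0 * v 0 i1 - u 0 i1 * v 0 i0)
                     (u 0 i1 * v 0 i2 - u 0 i2 * v 0 i1)
                     (u 0 i2 * v 0 i0 - u 0 i0 * v 0 i2).
Proof.
have wE i j : wedge u v i j = u 0 i * v 0 j - v 0 i * u 0 j.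
  by rewrite !mxE !big_ord1 !mxE.
by rewrite [LHS]in_ext2_alt_mx ?wE; [congr alt_mx; ring | exact: wedge_in_ext2].
Qed.

(** Coordinate [k] of the dual bracket is the pairing of [f /\ g] with the cobracket of the [k]-th
    basis vector. *)
Lemma dual_bracket_alt_mx (delta : 'rV[K]_3 -> 'M[K]_3) (f g : 'cV[K]_3) k
    p r q : delta (delta_mx 0 k) = alt_mx p r q ->
  dual_bracket delta f g k 0 =
    p * (f i0 0 * g i1 0 - f i1 0 * g i0 0)
  + r * (f i1 0 * g i2 0 - f i2 0 * g i1 0)
  + q * (f i2 0 * g i0 0 - f i0 0 * g i2 0).
Proof.
move=> e; rewrite mxE e mxE sum_ord3 ![(_ *m _) _ _]mxE !sum_ord3.
rewrite ![_^T _ _]mxE !mx3E; ring.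
Qed.

End AlternatingMatrices.

(** * Bracket, adjoint action and cobrackets in coordinates *)

Section R3.
Variable K : fieldType.

Lemma r3_bracketE (u v : 'rV[K]_3) :
  let b := r3_bracket u v in
  (b 0 i0 = u 0 i2 * v 0 i0 - u 0 i0 * v 0 i2
            + (u 0 i2 * v 0 i1 - u 0 i1 * v 0 i2)) *
  (b 0 i1 = u 0 i2 * v 0 i1 - u 0 i1 * v 0 i2) * (b 0 i2 = 0).
Proof.
rewrite /= /r3_bracket !mxE !eqxx !eq_ord3 /=.
by split; [split|]; rewrite /=; ring.
Qed.

Lemma r3_basisE :
  ((r3_x K 0 i0 = 1) * (r3_x K 0 i1 = 0) * (r3_x K 0 i2 = 0)) *
  ((r3_y K 0 i0 = 0) * (r3_y K 0 i1 = 1) * (r3_y K 0 i2 = 0)) *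
  ((r3_h K 0 i0 = 0) * (r3_h K 0 i1 = 0) * (r3_h K 0 i2 = 1)).
Proof. by rewrite !mxE !eqxx !eq_ord3. Qed.

Lemma r3_decomp (v : 'rV[K]_3) :
  v = v 0 i0 *: r3_x K + v 0 i1 *: r3_y K + v 0 i2 *: r3_h K.
Proof. by apply: row3P; rewrite !mx_linE !r3_basisE; ring. Qed.

Lemma r3_bracket_lie : is_lie_bracket (@r3_bracket K).
Proof.
by split=> [v a u w|v a u w|u|u v w]; apply: row3P;
  rewrite !(mx_linE, r3_bracketE); ring.
Qed.

Lemma r3_cobracketE (D : 'M[K]_3) (v : 'rV[K]_3) :
  let w i := D i i0 * v 0 i0 + D i i1 * v 0 i1 + D i i2 * v 0 i2 in
  r3_cobracket D v = alt_mx (w i0) (w i1) (w i2).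
Proof.
move=> w; rewrite /r3_cobracket !sum_ord3 /r3_ext2_basis !(tnth_nth 0) /=.
rewrite !inordK //= !wedge_alt_mx !r3_basisE !(alt_mxZ, alt_mxD).
by rewrite /w; congr alt_mx; ring.
Qed.

Lemma r3_cobracket_delta (D : 'M[K]_3) k :
  r3_cobracket D (delta_mx 0 k) = alt_mx (D i0 k) (D i1 k) (D i2 k).
Proof.
rewrite r3_cobracketE ![delta_mx _ _ _ _]mxE eqxx /=.
by case: (ord3_cases k) => ->; rewrite !eqxx !eq_ord3;
  congr alt_mx; rewrite /=; ring.
Qed.

(** Replaces an abstract cobracket by nine scalars, the unknowns of the cocycle and co-Jacobi
    equations. *)
Lemma linear_r3_cobracket (delta : 'rV[K]_3 -> 'M[K]_3) :
  linear delta -> (forall v, in_ext2 (delta v)) ->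
  forall v, delta v = r3_cobracket (mx3
    [:: [:: delta (r3_x K) i0 i1; delta (r3_y K) i0 i1; delta (r3_h K) i0 i1];
        [:: delta (r3_x K) i1 i2; delta (r3_y K) i1 i2; delta (r3_h K) i1 i2];
        [:: delta (r3_x K) i2 i0; delta (r3_y K) i2 i0; delta (r3_h K) i2 i0]])
    v.
Proof.
move=> lin_d ext_d v.
pose d : {linear 'rV[K]_3 -> 'M[K]_3} := HB.pack delta
  (GRing.isLinear.Build K _ _ _ delta lin_d).
have dE : delta v = v 0 i0 *: delta (r3_x K) + v 0 i1 *: delta (r3_y K)
                    + v 0 i2 *: delta (r3_h K).
  by rewrite {1}(r3_decomp v) -[delta]/(d : _ -> _) !linearD !linearZ.
rewrite dE (in_ext2_alt_mx (ext_d (r3_x K))) (in_ext2_alt_mx (ext_d (r3_y K))).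
rewrite (in_ext2_alt_mx (ext_d (r3_h K))) !(alt_mxZ, alt_mxD) r3_cobracketE.
by congr alt_mx; rewrite !mx3E; ring.
Qed.

(** Vectors are rows, so the rows are [[s, x]], [[s, y]] and [[s, h]]. *)
Lemma r3_adE (s : 'rV[K]_3) :
  lin1_mx (r3_bracket s) = mx3 [:: [:: s 0 i2; 0; 0];
                                   [:: s 0 i2; s 0 i2; 0];
                                   [:: - (s 0 i0 + s 0 i1); - s 0 i1; 0]].
Proof.
by apply: mx33P => i; case: (ord3_cases i) => ->; split;
  rewrite [LHS]mxE !r3_bracketE !mx3E ?r3_basisE; ring.
Qed.

(** The factor 2 is the trace of [ad h] on the span of [x] and [y]; the term [q - r] comes from
    [[h, y] /\ h = y /\ h - h /\ x]. *)
Lemma r3_ext2_actE (s : 'rV[K]_3) (p r q : K) :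
  ext2_act (@r3_bracket K) s (alt_mx p r q) =
  alt_mx (2 * s 0 i2 * p + s 0 i0 * r + s 0 i1 * (r + q)) (s 0 i2 * r)
         (s 0 i2 * (q - r)).
Proof.
rewrite /ext2_act r3_adE.
by apply: mx33P => i; case: (ord3_cases i) => ->; split;
  rewrite mx_linE !(mxE mulmx_key) !sum_ord3 !(mxE trmx_key) !mx3E; ring.
Qed.

Definition r3_family (c1 c3 b3 : K) : 'M[K]_3 :=
  mx3 [:: [:: 0; c3; c1]; [:: 0; 0; 0]; [:: 0; b3; c3]].

Lemma r3_familyE (c1 c3 b3 : K) (v : 'rV[K]_3) :
  r3_cobracket (r3_family c1 c3 b3) v =
    alt_mx (c3 * v 0 i1 + c1 * v 0 i2) 0 (b3 * v 0 i1 + c3 * v 0 i2).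
Proof. by rewrite r3_cobracketE; congr alt_mx; rewrite !mx3E; ring. Qed.

(** In the dual basis, [[X, Y] = c3 Y + c1 H], [[H, X] = b3 Y + c3 H] and [[Y, H] = 0]: [X] acts on
    an abelian ideal, so co-Jacobi holds for all parameters. *)
Lemma r3_family_dualE (c1 c3 b3 : K) (f g : 'cV[K]_3) :
  let b := dual_bracket (r3_cobracket (r3_family c1 c3 b3)) f g in
  let p := f i0 0 * g i1 0 - f i1 0 * g i0 0 in
  let q := f i2 0 * g i0 0 - f i0 0 * g i2 0 in
  (b i0 0 = 0) * (b i1 0 = c3 * p + b3 * q) * (b i2 0 = c1 * p + c3 * q).
Proof.
move=> b p q; rewrite /b !(dual_bracket_alt_mx _ _ (r3_cobracket_delta _ _)).
by rewrite !mx3E /p /q; split; [split|]; rewrite /=; ring.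
Qed.

Lemma r3_family_bialgebra (c1 c3 b3 : K) :
  is_lie_bialgebra (@r3_bracket K) (r3_cobracket (r3_family c1 c3 b3)).
Proof.
split; first exact: r3_bracket_lie.
- move=> a u v; rewrite !r3_familyE alt_mxZ alt_mxD.
  by congr alt_mx; rewrite !(mx_linE, mulr0); ring.
- by move=> v; rewrite r3_familyE; apply: alt_mx_in_ext2.
- by split=> [v a u w|v a u w|u|u v w]; apply: col3P;
    rewrite !(mx_linE, r3_family_dualE); ring.
- move=> s t; rewrite !r3_familyE !r3_ext2_actE alt_mxN alt_mxD !r3_bracketE.
  by congr alt_mx; ring.
Qed.

End R3.

(** * The cocycle and co-Jacobi equations *)

Lemma r3_bialgebra_family (K : realFieldType) (delta : 'rV[K]_3 -> 'M[K]_3) :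
  is_lie_bialgebra (@r3_bracket K) delta ->
  exists c1 c3 b3, forall v, delta v = r3_cobracket (r3_family c1 c3 b3) v.
Proof.
case=> _ lin_d ext_d coJ coc.
move: (linear_r3_cobracket lin_d ext_d).
(* Letters [a], [b], [c] stand for the cobrackets of [x], [y], [h]; indices 1, 2, 3 for the
   coordinates along [x /\ y], [y /\ h], [h /\ x]. *)
set a1 := delta (r3_x K) i0 i1; set b1 := delta (r3_y K) i0 i1.
set c1 := delta (r3_h K) i0 i1; set a2 := delta (r3_x K) i1 i2.
set b2 := delta (r3_y K) i1 i2; set c2 := delta (r3_h K) i1 i2.
set a3 := delta (r3_x K) i2 i0; set b3 := delta (r3_y K) i2 i0.
set c3 := delta (r3_h K) i2 i0; move: a1 b1 c1 a2 b2 c2 a3 b3 c3.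
move=> a1 b1 c1 a2 b2 c2 a3 b3 c3 dE.
move: (coc (r3_x K) (r3_y K)) (coc (r3_h K) (r3_x K)) (coc (r3_h K) (r3_y K)).
rewrite !dE !r3_cobracketE !r3_ext2_actE !alt_mxN !alt_mxD => {coc}.
move=> /alt_mx_inj[exy _ _] /alt_mx_inj[ehx1 _ ehx3] /alt_mx_inj[ehy1 _ ehy3].
move: exy ehx1 ehx3 ehy1 ehy3.
rewrite !mx3E !r3_bracketE !r3_basisE => exy ehx1 ehx3 ehy1 ehy3.
have dualE f g k := dual_bracket_alt_mx f g
  (etrans (dE (delta_mx 0 k)) (r3_cobracket_delta _ k)).
have J := lie_jacobi coJ (delta_mx i0 0) (delta_mx i1 0) (delta_mx i2 0).
have {J} := congr1 (fun f : 'cV_3 => f i2 0) J.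
rewrite [LHS]mxE [X in X + _]mxE !dualE !mx3E.
rewrite !mxE !eqxx !eq_ord3 /= => eJ.
(* The cocycle equations read [b2 = a2 + a3] on (x, y), [c2 = a1] and [a2 = 0] on (h, x),
   [b1 = a1 + c2 + c3] and [b2 = - a3] on (h, y); hence [2 a3 = 0]. *)
have a20 : a2 = 0 by lra.
have a30 : a3 = 0 by lra.
have b20 : b2 = 0 by lra.
have c2E : c2 = a1 by lra.
have b1E : b1 = 2 * a1 + c3 by lra.
(* The h-coordinate of the Jacobi identity for X, Y, H is a1 (c3 - b1). *)
have a10 : a1 = 0.
  have /eqP : a1 * a1 = 0 by move: eJ; rewrite a20 a30 b20 c2E b1E => eJ; lra.
  by rewrite mulf_eq0 orbb => /eqP.
exists c1, c3, b3 => v; rewrite dE.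
by rewrite /r3_family a20 a30 b20 c2E b1E a10 mulr0 add0r.
Qed.

(** * Automorphisms of the Lie algebra and their action on the parameters *)

Section Isomorphisms.
Variable K : fieldType.

(** On the span of [x] and [y], [ad (phi h)] is [t] times a unipotent Jordan block, with [t] the
    [h]-coordinate of [phi h]. The eigenvector [phi x] has eigenvalue 1, so [t = 1]; the relation
    for [phi y] then makes the two diagonal entries equal. *)
Lemma r3_auto_mx (phi : {linear 'rV[K]_3 -> 'rV[K]_3}) :
  injective phi ->
  (forall u v, phi (r3_bracket u v) = r3_bracket (phi u) (phi v)) ->
  exists2 a, a != 0 & exists b p q,
    lin1_mx phi = mx3 [:: [:: a; 0; 0]; [:: b; a; 0]; [:: p; q; 1]].
Proof.
move=> inj_phi morph.
have := morph (r3_h K) (r3_x K); rewrite r3_bracket_hx => ex.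
have := morph (r3_h K) (r3_y K); rewrite r3_bracket_hy linearD => ey.
have nz : phi (r3_x K) != 0.
  rewrite -(linear0 phi) (inj_eq inj_phi); apply/eqP => /rowP/(_ i0)/eqP.
  by rewrite mx_linE r3_basisE oner_eq0.
have -> : lin1_mx phi = mx3 [::
    [:: phi (r3_x K) 0 i0; phi (r3_x K) 0 i1; phi (r3_x K) 0 i2];
    [:: phi (r3_y K) 0 i0; phi (r3_y K) 0 i1; phi (r3_y K) 0 i2];
    [:: phi (r3_h K) 0 i0; phi (r3_h K) 0 i1; phi (r3_h K) 0 i2]].
  by apply: mx33P => i; case: (ord3_cases i) => ->; split;
    rewrite [LHS]mxE mx3E.
move: {morph} (phi (r3_x K)) (phi (r3_y K)) (phi (r3_h K)) nz ex ey => X Y H.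
move=> nz ex ey.
(* Every bracket has zero [h]-coordinate, so [X] and [Y] lie in the span of [x] and [y]. *)
have x2 : X 0 i2 = 0 by rewrite ex r3_bracketE.
have y2 : Y 0 i2 = 0.
  by have /rowP/(_ i2) := ey; rewrite mx_linE r3_bracketE x2 add0r.
have x1 : (H 0 i2 - 1) * X 0 i1 = 0.
  by rewrite mulrBl {2}ex r3_bracketE x2; ring.
have x0 : (H 0 i2 - 1) * X 0 i0 + H 0 i2 * X 0 i1 = 0.
  by rewrite mulrBl mul1r {2}ex r3_bracketE x2; ring.
have y1 : (H 0 i2 - 1) * Y 0 i1 = X 0 i1.
  have /rowP/(_ i1) := ey; rewrite mx_linE r3_bracketE y2 mulr0 subr0 => e.
  by rewrite mulrBl -e; ring.
have y0 : (H 0 i2 - 1) * Y 0 i0 + H 0 i2 * Y 0 i1 = X 0 i0.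
  have /rowP/(_ i0) := ey; rewrite mx_linE r3_bracketE y2 !mulr0 !subr0 => e.
  by rewrite -[RHS](addrK (Y 0 i0)) e; ring.
(* If [t = 1], equation [y1] gives the claim; otherwise [x1] does. *)
have X1 : X 0 i1 = 0.
  have [e|ne] := eqVneq (H 0 i2 - 1) 0; first by rewrite -y1 e mul0r.
  by move/eqP: x1; rewrite mulf_eq0 (negPf ne) => /eqP.
have X0 : X 0 i0 != 0.
  by apply: contra_neq nz => X0; apply: row3P; rewrite mx_linE.
have h2 : H 0 i2 = 1.
  by move/eqP: x0; rewrite X1 mulr0 addr0 mulf_eq0 (negPf X0) orbF subr_eq0
    => /eqP.
exists (X 0 i0) => //; exists (Y 0 i0), (H 0 i0), (H 0 i1).
have Y1 : Y 0 i1 = X 0 i0 by rewrite -y0 h2; ring.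
by rewrite x2 y2 X1 h2 Y1.
Qed.

(** Here [phi x /\ phi y = a^2 x /\ y] and [phi h /\ phi x = a h /\ x - a q x /\ y]. *)
Lemma r3_auto_ext2 (a b p q u w : K) :
  let M := mx3 [:: [:: a; 0; 0]; [:: b; a; 0]; [:: p; q; 1]] in
  M^T *m alt_mx u 0 w *m M = alt_mx (a ^+ 2 * u - a * q * w) 0 (a * w).
Proof.
move=> M; apply: mx33P => i; case: (ord3_cases i) => ->; split;
  rewrite !(mxE mulmx_key) !sum_ord3 !(mxE mulmx_key) !sum_ord3;
  rewrite !(mxE trmx_key) !mx3E; ring.
Qed.

(* Only the entries a and q of an automorphism x |-> a x, y |-> a y + b x,
   h |-> h + p x + q y act on the parameters of the family. *)
Definition r3_family_equiv (c1 c3 b3 c1' c3' b3' : K) : Prop :=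
  exists2 a, a != 0 & exists q,
    [/\ b3' = b3, c3' = a * c3 - q * b3
      & c1' = a ^+ 2 * c1 - 2 * a * q * c3 + q ^+ 2 * b3].

Lemma r3_family_isoP (delta : 'rV[K]_3 -> 'M[K]_3) (c1 c3 b3 c1' c3' b3' : K) :
  (forall v, delta v = r3_cobracket (r3_family c1 c3 b3) v) ->
  lie_bialgebra_iso (@r3_bracket K) delta
    (@r3_bracket K) (r3_cobracket (r3_family c1' c3' b3')) <->
  r3_family_equiv c1 c3 b3 c1' c3' b3'.
Proof.
move=> dE; split.
  case=> phi [bij morph cob].
  have [a a0 [b [p [q M]]]] := r3_auto_mx (bij_inj bij) morph.
  have phiE v j : phi v 0 j = (v *m lin1_mx phi) 0 j by rewrite mul_rV_lin1.
  exists a => //; exists q.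
  (* Comparing coordinates at [y] and [h] suffices to read off all three parameters. *)
  have := cob (r3_h K); have := cob (r3_y K).
  rewrite !dE !r3_familyE !r3_basisE /ext2_map M !r3_auto_ext2 !phiE M.
  rewrite ![(_ *m mx3 _) _ _]mxE !sum_ord3 !r3_basisE !mx3E.
  rewrite !(mul0r, mulr0, add0r, addr0, mul1r, mulr1).
  move=> /alt_mx_inj[ey1 _ ey3] /alt_mx_inj[eh1 _ eh3].
  have b3E : b3' = b3.
    by apply: (mulfI a0); rewrite -ey3 mulrC.
  have c3E : c3' = a * c3 - q * b3.
    by rewrite -eh3 b3E; ring.
  split=> //; apply: (addrI (c3' * q)); rewrite eh1 c3E; ring.
case=> a a0 [q [-> -> ->]].
(* The simplest automorphism with the given [a] and [q], followed by its inverse. *)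
pose M := mx3 [:: [:: a; 0; 0]; [:: 0; a; 0]; [:: 0; q; 1]].
pose N := mx3 [:: [:: a^-1; 0; 0]; [:: 0; a^-1; 0]; [:: 0; - (a^-1 * q); 1]].
have MN : M *m N = 1%:M.
  by apply: mx33P => i; case: (ord3_cases i) => ->; split;
    rewrite !mxE !sum_ord3 !mx3E ?eqxx ?eq_ord3 /=; field.
have mulE v : let w := v *m M in
    (w 0 i0 = a * v 0 i0) * (w 0 i1 = a * v 0 i1 + q * v 0 i2)
    * (w 0 i2 = v 0 i2).
  by rewrite /= !mxE !sum_ord3 !mx3E; split; [split|]; rewrite /=; ring.
exists (mulmxr M); split.
- exists (mulmxr N) => v /=; rewrite -mulmxA ?MN ?mulmx1 //.
  by rewrite (mulmx1C MN) mulmx1.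
- by move=> u v /=; apply: row3P; rewrite !(mulE, r3_bracketE); ring.
move=> v; have -> : ext2_map (mulmxr M) (delta v) = M^T *m delta v *m M.
  rewrite /ext2_map; suff -> : lin1_mx (mulmxr M) = M by [].
  by apply/matrixP => i j; rewrite mxE /= -rowE mxE.
rewrite dE !r3_familyE r3_auto_ext2 /= !mulE.
by congr alt_mx; ring.
Qed.

End Isomorphisms.

(** * Normal forms of the parameters *)

Definition r3_normal (K : fieldType) (c1 c3 b3 : K) : Prop :=
  (c1, c3, b3) = (0, 1, 0) \/ c1 \in [:: 0; 1; -1] /\ c3 = 0.

Lemma r3_listedP (K : fieldType) (D : 'M[K]_3) :
  r3_listed D <->
  exists c1 c3 b3, r3_normal c1 c3 b3 /\ D = r3_family c1 c3 b3.
Proof.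
split=> [[->|[c1 [b3 [c1P ->]]]]|[c1 [c3 [b3 [[[-> -> ->]|[c1P ->]] ->]]]]].
- by exists 0, 1, 0; split; first by left.
- by exists c1, 0, b3; split; first by right.
- by left.
- by right; exists c1, b3.
Qed.

(** For nonzero [c], take [a] to be the inverse square root of its absolute value; this is why the
    field is real closed. *)
Lemma sgr_sqr_mul (R : rcfType) (c : R) :
  exists2 a, a != 0 & Num.sg c = a ^+ 2 * c.
Proof.
have [->|c0] := eqVneq c 0.
  by exists 1; rewrite ?oner_eq0 // sgr0 mulr0.
have n0 : 0 < `|c| by rewrite normr_gt0.
exists (Num.sqrt `|c|)^-1; first by rewrite invr_eq0 gt_eqF ?sqrtr_gt0.
rewrite exprVn sqr_sqrtr ?normr_ge0 //; apply: (mulfI (lt0r_neq0 n0)).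
by rewrite mulVKf ?lt0r_neq0 // mulrC -numEsg.
Qed.

Lemma sgr_id_mem (R : realDomainType) (c : R) :
  c \in [:: 0; 1; -1] -> Num.sg c = c.
Proof.
by rewrite !inE => /or3P[] /eqP ->; rewrite ?sgrN ?sgr1 ?sgr0.
Qed.

Lemma sgr_mem (R : realDomainType) (c : R) : Num.sg c \in [:: 0; 1; -1].
Proof. by rewrite !inE; case: sgrP; rewrite eqxx ?orbT. Qed.

Lemma r3_normal_form (R : rcfType) (c1 c3 b3 : R) :
  exists d1 d3 e3,
    [/\ r3_normal d1 d3 e3, r3_family_equiv c1 c3 b3 d1 d3 e3
      & forall d1' d3' e3', r3_normal d1' d3' e3' ->
          r3_family_equiv c1 c3 b3 d1' d3' e3' ->
          (d1', d3', e3') = (d1, d3, e3)].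
Proof.
have [b0|b0] := eqVneq b3 0; last first.
  (* [c] is the value of [c1] once [c3] is killed by [a = 1], [q = c3 / b3]; for general [a], the
     choice [q = a c3 / b3] gives [a^2 c]. *)
  pose c := c1 - c3 ^+ 2 / b3; have [a a0 sE] := sgr_sqr_mul c.
  exists (Num.sg c), 0, b3; split; first by right; split=> //; apply: sgr_mem.
    exists a => //; exists (a * c3 / b3); split=> //; first by field.
    by rewrite sE /c; field.
  move=> d1 d3 e3 dN [a' a'0 [q [e3E d3E d1E]]].
  case: dN => [[_ _ e30]|[d1P d30]]; first by rewrite -e3E e30 eqxx in b0.
  (* Vanishing of the new [c3] forces [q], so [d1] is a positive multiple of [c] and has its
     sign. *)
  have qE : q = a' * c3 / b3.
    by apply: (mulIf b0); rewrite divfK //; move: d3E; rewrite d30 => /eqP;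
      rewrite eq_sym subr_eq0 => /eqP ->.
  have dE : d1 = a' ^+ 2 * c by rewrite d1E qE /c; field.
  rewrite d30 e3E -(sgr_id_mem d1P) dE sgrM gtr0_sg ?mul1r //.
  by rewrite exprn_even_gt0.
rewrite {}b0; have [c0|c0] := eqVneq c3 0; last first.
  exists 0, 1, 0; split; first by left.
    exists c3^-1; first by rewrite invr_eq0.
    (* With [a = 1 / c3], this [q] solves [a^2 c1 - 2 a q c3 = 0]. *)
    by exists (c3^-1 ^+ 2 * c1 / 2); split=> //; field.
  (* A normal form with [c3 = 0] is excluded, since the new [c3] is [a c3], which is nonzero. *)
  move=> d1 d3 e3 [[-> -> ->] //|[_ d30]] [a a0 [q [_ d3E _]]].
  move: d3E; rewrite d30 mulr0 subr0 => /esym/eqP.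
  by rewrite mulf_eq0 (negPf a0) (negPf c0).
rewrite {}c0; have [a a0 sE] := sgr_sqr_mul c1.
exists (Num.sg c1), 0, 0; split; first by right; split=> //; apply: sgr_mem.
  by exists a => //; exists 0; split=> //; rewrite ?sE; ring.
(* Now [c3] stays 0 and [c1] is multiplied by the positive number [a'^2], so its sign is
   invariant. *)
move=> d1 d3 e3 dN [a' a'0 [q [-> d3E d1E]]].
have d30 : d3 = 0 by rewrite d3E; ring.
case: dN => [[_ d31 _]|[d1P _]].
  by have := oner_eq0 R; rewrite -d31 d30 eqxx.
rewrite d30 -(sgr_id_mem d1P) d1E !mulr0 subr0 addr0 sgrM gtr0_sg ?mul1r //.
by rewrite exprn_even_gt0.
Qed.

Theorem theorem5p2 (R : realType) :
  (forall D : 'M[R]_3, r3_listed D ->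
     is_lie_bialgebra (@r3_bracket R) (r3_cobracket D)) /\
  (forall delta : 'rV[R]_3 -> 'M[R]_3,
     is_lie_bialgebra (@r3_bracket R) delta ->
     exists! D : 'M[R]_3, r3_listed D /\
       lie_bialgebra_iso (@r3_bracket R) delta
                         (@r3_bracket R) (r3_cobracket D)).
Proof.
split=> [D /r3_listedP[c1 [c3 [b3 [_ ->]]]]|delta bialg].
  exact: r3_family_bialgebra.
have [c1 [c3 [b3 dE]]] := r3_bialgebra_family bialg.
have [d1 [d3 [e3 [dN dQ dU]]]] := r3_normal_form c1 c3 b3.
exists (r3_family d1 d3 e3); split.
  split; first by apply/r3_listedP; exists d1, d3, e3.
  exact/(r3_family_isoP _ _ _ dE).
move=> D [/r3_listedP[d1' [d3' [e3' [dN' ->]]]]].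
by move/(r3_family_isoP _ _ _ dE) => /(dU _ _ _ dN')[-> -> ->].
Qed.
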